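(* Every damping family $\{F_\lambda\}$ of symmetric functions presents a basis phenomenon: its elements are linearly independent and for all partitions $\mu,\nu$ the product $F_\mu F_\nu$ expands as a finite linear combination $\sum_\lambda c^\lambda_{\mu\nu}F_\lambda$.
   Context: Let $\hat\Lambda$ be the completion of the ring of symmetric functions in $\mathbf{x}=(x_1,x_2,\ldots)$. A family $\{F_\lambda\}$ indexed by partitions, $F_\lambda\in\hat\Lambda$, $F_\varnothing=1$, is damping if: (i) it is linearly independent in $\hat\Lambda$ and every element of $\hat\Lambda$ is uniquely expressible as a (possibly infinite) linear combination of the $F_\lambda$; (ii) there is an involutive automorphism $\widehat\omega$ with $\widehat\omega(F_\lambda)=F_{\lambda'}$ ($\lambda'$ the conjugate partition); (iii) there is a Pieri-type formula $\sum_\lambda F_\lambda(\mathbf{x})f_{\lambda\mu}(\mathbf{y})=\Omega(\mathbf{x},\mathbf{y})F_\mu(\mathbf{x})$ for all $\mu$, for some non-degenerate kernel $\Omega$ and a dual family of symmetric functions $\{f_{\lambda\mu}\}$ such that (a) (damping condition) for each $\mu$ and $n\in\mathbb{N}$ there is a constant $k=k(\mu,n)$ such that $f_{\lambda\mu}(x_1,\ldots,x_n)\neq0$ implies $\lambda_1<k$, and (b) the functions $f_\lambda:=f_{\lambda\varnothing}$ are linearly independent.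
   Formalization: Coefficients lie in a field and the involution is continuous. ''Non-degenerate'' is strengthened, since the plain reading is false: for each λ there is n such that every continuous functional killing Ω(x; y_1,…,y_n) kills F_λ. *)

(* Defs.v *)
From HB Require Import structures.
From mathcomp Require Import all_boot all_order all_algebra.
From mathcomp Require Import finmap multiset.
From mathcomp Require Import mathcomp_extra boolp classical_sets functions.
From mathcomp Require Import cardinality fsbigop.

Set Implicit Arguments.
Unset Strict Implicit.
Unset Printing Implicit Defensive.

Import Order.TTheory GRing.Theory.

Local Open Scope classical_set_scope.
Local Open Scope ring_scope.

Definition is_part (s : seq nat) : bool := sorted geq s && (0%N \notin s).

Record intpart := IntPart { parts :> seq nat; _ : is_part parts }.

HB.instance Definition _ := [isSub for parts].
HB.instance Definition _ := [Countable of intpart by <:].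

Definition empty_part : intpart := @IntPart [::] isT.

Definition part1 (la : intpart) : nat := head 0%N la.

Definition conj_seq (s : seq nat) : seq nat :=
  [seq count (fun x => j < x)%N s | j <- iota 0 (head 0%N s)].

Lemma conj_seqP (la : intpart) : is_part (conj_seq la).
Proof.
case: la => s /= _; apply/andP; split; rewrite /conj_seq.
  apply: (@homo_sorted _ _ _ leq) (iota_sorted 0 (head 0%N s)) => i j ij.
  by apply: sub_count => x; apply: leq_ltn_trans.
apply/mapP=> -[j]; rewrite mem_iota add0n /= => js /esym/eqP.
by case: s js => [//|x s] /= ->.
Qed.

Definition conj_part (la : intpart) : intpart := IntPart (conj_seqP la).

(* Monomials in x_0, x_1, x_2, ...: the monomial m has exponent m i in x_i, and
   `+` is the product of monomials. *)
Notation mon := {mset nat}%mset.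

Definition rename_mon (s : nat -> nat) (m : mon) : mon :=
  seq_mset [seq s i | i <- m].

Definition mon_pairs (m : mon) : set (mon * mon) :=
  [set p | msetD p.1 p.2 = m].

Section MonTheory.

Lemma rename_monE s : bijective s -> forall m i, rename_mon s m (s i) = m i.
Proof.
move=> /bij_inj si m i; rewrite mset_seqE count_map -count_mem_mset.
by apply: eq_count => j /=; rewrite inj_eq.
Qed.

Lemma rename_monD s m1 m2 : bijective s ->
  rename_mon s (msetD m1 m2) = msetD (rename_mon s m1) (rename_mon s m2).
Proof.
move=> sb; have [t st ts] := sb; apply/msetP => i.
by rewrite -(ts i) msetE2 !rename_monE // msetE2.
Qed.

Lemma rename_monK s t : cancel s t -> cancel t s ->
  cancel (rename_mon s) (rename_mon t).
Proof.
move=> st ts m; apply/msetP => i; rewrite -{1}(st i) rename_monE; last by exists s.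
by rewrite rename_monE //; exists t.
Qed.

Lemma rename_mon0 s : rename_mon s mset0 = mset0.
Proof.
rewrite /rename_mon enum_mset0 /=; apply/msetP => i.
by rewrite mset_seqE mset0E.
Qed.

Lemma finite_mon_pairs m : finite_set (mon_pairs m).
Proof.
pose h (b : (size m).-tuple bool) : mon * mon :=
  let a := seq_mset (mask b m) in (a, msetB m a).
apply: (@sub_finite_set _ _ (range h)); last exact/finite_image/finite_finset.
move=> [a b] /= ab.
have /count_subseqP[s /subseqP[t st ->] as_] :
    forall x, (count_mem x a <= count_mem x m)%N.
  by move=> x; rewrite !count_mem_mset -ab msetE2 leq_addr.
have sa : seq_mset (mask t m) = a.
  by rewrite -[RHS]seq_mset_id; apply/eq_seq_msetP; rewrite perm_sym.
have tt : size t == size m by apply/eqP.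
by exists (Tuple tt) => //; rewrite /h /= sa -ab msetDKB.
Qed.

End MonTheory.

Definition is_symmetric (R : Type) (f : mon -> R) : Prop :=
  forall s : nat -> nat, bijective s -> forall m, f (rename_mon s m) = f m.

(* The completed ring of symmetric functions over R: symmetric formal power
   series of possibly unbounded degree in infinitely many variables, given by
   their coefficients. *)
Record symser (R : Type) := SymSer {
  mcoef : mon -> R;
  mcoefP : is_symmetric mcoef
}.

HB.instance Definition _ (R : Type) := gen_eqMixin (symser R).
HB.instance Definition _ (R : Type) := gen_choiceMixin (symser R).

Lemma symserP (R : Type) (f g : symser R) : mcoef f =1 mcoef g -> f = g.
Proof.
case: f g => [f fP] [g gP] /= /funext fg; subst g.
by congr SymSer; apply: Prop_irrelevance.
Qed.

Lemma map_symser_subproof (R S : Type) (h : R -> S) (f : symser R) :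
  is_symmetric (fun m => h (mcoef f m)).
Proof. by move=> s sb m; rewrite mcoefP. Qed.

Definition map_symser (R S : Type) (h : R -> S) (f : symser R) : symser S :=
  SymSer (map_symser_subproof h f).

Section SymserZmod.
Variable R : zmodType.
Implicit Types f g : symser R.

Lemma symser_add_subproof f g : is_symmetric (fun m => mcoef f m + mcoef g m).
Proof. by move=> s sb m; rewrite !mcoefP. Qed.

Lemma symser_zero_subproof : is_symmetric (fun _ => 0 : R).
Proof. by []. Qed.

Definition symser_add f g := SymSer (symser_add_subproof f g).
Definition symser_zero := SymSer symser_zero_subproof.
Definition symser_opp f := map_symser -%R f.

Fact symser_addA : associative symser_add.
Proof. by move=> f g h; apply: symserP => m /=; rewrite addrA. Qed.
Fact symser_addC : commutative symser_add.
Proof. by move=> f g; apply: symserP => m /=; rewrite addrC. Qed.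
Fact symser_add0 : left_id symser_zero symser_add.
Proof. by move=> f; apply: symserP => m /=; rewrite add0r. Qed.
Fact symser_addN : left_inverse symser_zero symser_opp symser_add.
Proof. by move=> f; apply: symserP => m /=; rewrite addNr. Qed.

HB.instance Definition _ := GRing.isZmodule.Build (symser R)
  symser_addA symser_addC symser_add0 symser_addN.

End SymserZmod.

Section SymserRing.
Variable R : comNzRingType.
Implicit Types f g h : symser R.

Definition mulcoef f g (m : mon) : R :=
  \sum_(p \in mon_pairs m) mcoef f p.1 * mcoef g p.2.

Let D m := fset_set (mon_pairs m).

Let inD m p : (p \in D m) = (msetD p.1 p.2 == m).
Proof.
rewrite in_fset_set; last exact: finite_mon_pairs.
by apply/idP/eqP; rewrite inE.
Qed.

Lemma mulcoefE f g m :
  mulcoef f g m = \sum_(p <- D m) mcoef f p.1 * mcoef g p.2.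
Proof. by rewrite /mulcoef fsbig_finite //; apply: finite_mon_pairs. Qed.

Let sumD_bij (I J : choiceType) (r : seq I) (r' : seq J) (h : I -> J)
  (k : J -> I) (F : J -> R) :
  uniq r -> uniq r' -> (forall i, i \in r -> h i \in r' /\ k (h i) = i) ->
  (forall j, j \in r' -> k j \in r /\ h (k j) = j) ->
  \sum_(j <- r') F j = \sum_(i <- r) F (h i).
Proof.
move=> ru r'u hr kr; rewrite -(big_map h predT F); apply: perm_big.
apply: uniq_perm => //.
  rewrite map_inj_in_uniq // => i j /hr[_ ki] /hr[_ kj] hij.
  by rewrite -ki -kj hij.
move=> j; apply/idP/mapP => [/kr[kjr kj]|[i /hr[hir _] ->//]].
by exists (k j).
Qed.

Lemma symser_mul_subproof f g : is_symmetric (mulcoef f g).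
Proof.
move=> s sb m; have [t st ts] := sb; have tb : bijective t by exists s.
rewrite !mulcoefE.
rewrite (sumD_bij (r := D m)
  (h := fun p => (rename_mon s p.1, rename_mon s p.2))
  (k := fun p => (rename_mon t p.1, rename_mon t p.2))) //.
- by apply: eq_bigr => p _ /=; rewrite !mcoefP.
- move=> [a b]; rewrite !inD /= => /eqP <-; rewrite rename_monD // eqxx.
  by rewrite !(rename_monK st ts).
- move=> [a b]; rewrite !inD /= -rename_monD // => /eqP ->.
  by rewrite !(rename_monK st ts, rename_monK ts st) eqxx.
Qed.

Lemma symser_one_subproof : is_symmetric (fun m : mon => (m == mset0)%:R : R).
Proof.
move=> s [t st ts] m; congr (nat_of_bool _)%:R; apply/eqP/eqP => [m0|->].
  by rewrite -(rename_monK st ts m) m0 rename_mon0.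
exact: rename_mon0.
Qed.

Definition symser_mul f g := SymSer (symser_mul_subproof f g).
Definition symser_one := SymSer symser_one_subproof.

Fact symser_mulC : commutative symser_mul.
Proof.
move=> f g; apply: symserP => m /=; rewrite !mulcoefE.
rewrite (sumD_bij (r := D m) (h := fun p => (p.2, p.1))
  (k := fun p => (p.2, p.1))) //.
- by apply: eq_bigr => p _ /=; rewrite mulrC.
- by move=> [a b]; rewrite !inD /= msetDC.
- by move=> [a b]; rewrite !inD /= msetDC.
Qed.

Fact symser_mul1 : left_id symser_one symser_mul.
Proof.
move=> f; apply: symserP => m /=; rewrite mulcoefE.
rewrite (big_fsetD1 (mset0, m)) /=; last by rewrite inD /= mset0D.
rewrite eqxx mul1r big1_fset ?addr0 // => -[a b].
rewrite in_fsetD1 inD /= => /andP[ab /eqP abm] _.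
case: (a =P mset0) => [a0|]; last by rewrite mul0r.
by rewrite -abm a0 mset0D eqxx in ab.
Qed.

Fact symser_mulDl : left_distributive symser_mul +%R.
Proof.
move=> f g h; apply: symserP => m /=; rewrite !mulcoefE -big_split.
by apply: eq_bigr => p _; rewrite mulrDl.
Qed.

Fact symser_mulA : associative symser_mul.
Proof.
move=> f g h; apply: symserP => m /=; rewrite !mulcoefE.
under eq_bigr => p _ do rewrite /= mulcoefE mulr_sumr.
under [RHS]eq_bigr => p _ do rewrite /= mulcoefE mulr_suml.
pose r1 := [seq (p, q) | p <- D m, q <- D p.2].
pose r2 := [seq (p, q) | p <- D m, q <- D p.1].
have u1 : uniq r1.
  apply: allpairs_uniq_dep => [|p _|[p q] [p' q'] _ _ /= [-> ->] //];
  exact: fset_uniq.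
have u2 : uniq r2.
  apply: allpairs_uniq_dep => [|p _|[p q] [p' q'] _ _ /= [-> ->] //];
  exact: fset_uniq.
pose F1 (z : (mon * mon) * (mon * mon)) :=
  mcoef f z.1.1 * (mcoef g z.2.1 * mcoef h z.2.2).
pose F2 (z : (mon * mon) * (mon * mon)) :=
  mcoef f z.2.1 * mcoef g z.2.2 * mcoef h z.1.2.
transitivity (\sum_(z <- r1) F1 z); first by rewrite big_allpairs_dep.
transitivity (\sum_(z <- r2) F2 z); last by rewrite big_allpairs_dep.
rewrite [RHS](sumD_bij (r := r1)
  (h := fun z => ((msetD z.1.1 z.2.1, z.2.2), (z.1.1, z.2.1)))
  (k := fun z => ((z.2.1, msetD z.2.2 z.1.2), (z.2.2, z.1.2)))) //.
- by apply: eq_bigr => z _; rewrite /F1 /F2 /= mulrA.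
- move=> [[a b] [c d]] /allpairsPdep[[a' b'] [[c' d']]] /= [+ + [-> -> -> ->]].
  rewrite !inD /= => /eqP abm /eqP cdb; split; last by rewrite cdb.
  apply/allpairsPdep; exists (msetD a' c', d'), (a', c').
  by rewrite !inD /= -msetDA cdb abm !eqxx.
- move=> [[a b] [c d]] /allpairsPdep[[a' b'] [[c' d']]] /= [+ + [-> -> -> ->]].
  rewrite !inD /= => /eqP abm /eqP cda; split; last by rewrite cda.
  apply/allpairsPdep; exists (c', msetD d' b'), (d', b').
  by rewrite !inD /= msetDA cda abm !eqxx.
Qed.

Fact symser_oner_neq0 : symser_one != 0.
Proof.
apply/eqP => /(congr1 (fun f : symser R => mcoef f mset0)) /= /eqP.
by rewrite eqxx oner_eq0.
Qed.

HB.instance Definition _ := GRing.Zmodule_isComNzRing.Build (symser R)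
  symser_mulA symser_mulC symser_mul1 symser_mulDl symser_oner_neq0.

Definition symser_scale (a : R) f := map_symser (fun c => a * c) f.

Fact symser_scaleA a b f :
  symser_scale a (symser_scale b f) = symser_scale (a * b) f.
Proof. by apply: symserP => m /=; rewrite mulrA. Qed.
Fact symser_scale1 : left_id 1 symser_scale.
Proof. by move=> f; apply: symserP => m /=; rewrite mul1r. Qed.
Fact symser_scaleDr : right_distributive symser_scale +%R.
Proof. by move=> a f g; apply: symserP => m /=; rewrite mulrDr. Qed.
Fact symser_scaleDl f : {morph symser_scale^~ f : a b / a + b}.
Proof. by move=> a b; apply: symserP => m /=; rewrite mulrDl. Qed.

HB.instance Definition _ := GRing.Zmodule_isLmodule.Build R (symser R)
  symser_scaleA symser_scale1 symser_scaleDr symser_scaleDl.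

Fact symser_scaleAl (a : R) f g : a *: (f * g) = (a *: f) * g.
Proof.
apply: symserP => m /=; rewrite !mulcoefE mulr_sumr.
by apply: eq_bigr => p _; rewrite mulrA.
Qed.

HB.instance Definition _ :=
  GRing.Lmodule_isLalgebra.Build R (symser R) symser_scaleAl.
HB.instance Definition _ := GRing.Lalgebra_isComAlgebra.Build R (symser R).

End SymserRing.

(* Convergence of a possibly infinite sum: every coefficient of the sum involves
   finitely many nonzero terms. *)
Definition has_sum (R : zmodType) (I : choiceType) (u : I -> symser R)
    (g : symser R) : Prop :=
  forall m, finite_set [set i | mcoef (u i) m <> 0] /\
            mcoef g m = \sum_(i \in [set: I]) mcoef (u i) m.

Section Damping.
Variable K : fieldType.
Implicit Types (F : intpart -> symser K) (Om : symser (symser K)).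

Definition lin_indep F : Prop :=
  forall (S : {fset intpart}) (c : intpart -> K),
    \sum_(la <- S) c la *: F la = 0 -> forall la, la \in S -> c la = 0.

Definition unique_expansion F : Prop :=
  forall g, exists! a : intpart -> K, has_sum (fun la => a la *: F la) g.

(* Continuity of a linear functional on symser K, for the topology of
   coefficientwise convergence with K discrete. *)
Definition continuous_functional (phi : symser K -> K) : Prop :=
  exists M : seq mon,
    forall g, (forall m, m \in M -> mcoef g m = 0) -> phi g = 0.

Definition continuous_operator (w : symser K -> symser K) : Prop :=
  forall m, continuous_functional (fun g => mcoef (w g) m).

Definition in_vars (n : nat) (m : mon) : bool := all (fun i => i < n)%N m.

(* f(x_0, ..., x_{n-1}) <> 0, where f(x_0, ..., x_{n-1}) is f with all other
   variables set to 0. *)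
Definition nonzero_in_vars (n : nat) (f : symser K) : Prop :=
  exists2 m, in_vars n m & mcoef f m <> 0.

(* A kernel Omega(x, y) is a symmetric series in y whose coefficients are
   symmetric series in x.  It pairs continuous functionals in x with continuous
   functionals in y.  Nondegeneracy on the x side is required to be visible on
   finitely many y-variables: a functional killing Omega(x; y_0, ..., y_{n-1})
   kills F_la as soon as n is large enough with respect to la.  (With F as in
   unique_expansion, this implies that a functional killing Omega is zero.  The
   latter alone is too weak to be used with the damping condition, since linearly
   independent f_la may become dependent in every finite set of variables.) *)
Definition nondegenerate_kernel F Om : Prop :=
  (forall la, exists n, forall phi : {scalar symser K},
     continuous_functional phi ->
     (forall b, in_vars n b -> phi (mcoef Om b) = 0) -> phi (F la) = 0) /\
  (forall psi : {scalar symser K},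
     continuous_functional psi ->
     (forall a, psi (map_symser (fun g => mcoef g a) Om) = 0) ->
     forall g, psi g = 0).

(* sum_la F_la(x) f_{la,mu}(y) = Omega(x, y) F_mu(x), comparing the coefficients
   of each monomial b in y. *)
Definition pieri_formula F (f : intpart -> intpart -> symser K) Om : Prop :=
  forall (mu : intpart) (b : mon),
    has_sum (fun la => mcoef (f la mu) b *: F la) (mcoef Om b * F mu).

Definition damping_condition (f : intpart -> intpart -> symser K) : Prop :=
  forall (mu : intpart) (n : nat), exists k : nat,
    forall la, nonzero_in_vars n (f la mu) -> (part1 la < k)%N.

(* The automorphism w is one of the completed algebra, hence continuous: it is
   compatible with infinite linear combinations. *)
Record damping_family F : Prop := DampingFamily {
  damping_empty : F empty_part = 1;
  damping_indep : lin_indep F;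
  damping_expansion : unique_expansion F;
  damping_omega : exists w : {lrmorphism symser K -> symser K},
    [/\ involutive w, continuous_operator w &
        forall la, w (F la) = F (conj_part la)];
  damping_pieri : exists Om f,
    [/\ nondegenerate_kernel F Om, pieri_formula F f Om, damping_condition f &
        lin_indep (fun la => f la empty_part)]
}.

Definition basis_phenomenon F : Prop :=
  lin_indep F /\
  forall mu nu, exists (S : {fset intpart}) (c : intpart -> K),
    F mu * F nu = \sum_(la <- S) c la *: F la.

End Damping.

(* Main.v *)
(* Every coefficient functional of the expansions g = sum_la a_la F_la is
   continuous, i.e. a finite combination of monomial coefficients; this is an
   automatic continuity statement, obtained from the uniqueness of expansions and
   a Baire category argument (no convergence of F_la to 0 is assumed).  Let phi
   compute the coefficient of F_la.  By the Pieri formula, g |-> phi (g F_mu)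
   sends the coefficient of y^b in Omega to that of y^b in f_(la,mu), which
   vanishes for all b in n variables when la_1 is large.  By nondegeneracy it then
   kills F_nu, so that la_1 is bounded in F_mu F_nu.  Applying omega, the length
   of la is bounded as well, and finitely many partitions remain. *)
From HB Require Import structures.
From mathcomp Require Import all_boot all_order all_algebra.
From mathcomp Require Import finmap multiset.
From mathcomp Require Import boolp classical_sets functions cardinality fsbigop.
Require Import Defs.

Set Implicit Arguments.
Unset Strict Implicit.
Unset Printing Implicit Defensive.

Import Order.TTheory GRing.Theory.

Local Open Scope classical_set_scope.
Local Open Scope ring_scope.

Section PolySubspaces.
Variable K : fieldType.
Implicit Types (Q : set {poly K}) (p q : {poly K}).

Definition poly_subspace Q : Prop :=
  forall (a : K) p q, Q p -> Q q -> Q (a *: p + q).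

Lemma poly_subspace_eq Q Q' : poly_subspace Q -> poly_subspace Q' -> Q' 0 ->
  Q' `<=` Q -> (forall p, Q p -> exists2 q, Q' q & size q = size p) ->
  Q `<=` Q'.
Proof.
move=> Ql Q'l Q'0 sQ'Q sz p; have [n] := ubnP (size p).
elim: n p => // n IHn p /ltnSE lepn Qp.
have [->//|p0] := eqVneq p 0.
have [q Q'q szq] := sz p Qp.
have q0 : q != 0 by rewrite -size_poly_gt0 szq size_poly_gt0.
pose a := lead_coef p / lead_coef q.
have Q'r : Q' (- a *: q + p).
  apply: IHn; last by apply: Ql => //; apply: sQ'Q.
  apply: leq_trans lepn; rewrite -[X in (_ < X)%N]prednK ?size_poly_gt0 // ltnS.
  apply/leq_sizeP => j; rewrite leq_eqVlt => /predU1P[<-|ltj].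
    rewrite coefD coefZ -{1}szq -!lead_coefE /a mulNr divfK ?lead_coef_eq0 //.
    by rewrite addNr.
  have szj : (size p <= j)%N by rewrite -(prednK (_ : 0 < size p)%N) ?size_poly_gt0.
  by rewrite coefD coefZ !nth_default ?mulr0 ?addr0 ?szq.
have -> : p = a *: q + (- a *: q + p) by rewrite addrA -scalerDl subrr scale0r add0r.
exact: Q'l.
Qed.

Lemma unbounded_kernel Q (l : {poly K} -> K) : poly_subspace Q -> scalar l ->
  (forall d, exists2 p, Q p & d < size p)%N ->
  forall d, exists2 p, Q p /\ l p = 0 & (d < size p)%N.
Proof.
move=> Ql ll unb d; have [p Qp dp] := unb d; have [q Qq pq] := unb (size p).
have [lp|lp] := eqVneq (l p) 0; first by exists p.
exists (- (l q / l p) *: p + q); first split.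
- exact: Ql.
- by rewrite ll /= mulNr divfK // addNr.
- rewrite addrC size_polyDl ?(ltn_trans dp) //.
  exact: leq_ltn_trans (size_scale_leq _ _) pq.
Qed.

Lemma kernel_combination (L : eqType) (r : {poly K} -> K)
    (l : L -> {poly K} -> K) (s : seq L) Q :
    poly_subspace Q -> scalar r -> (forall i, scalar (l i)) ->
    (forall p, Q p -> (forall i, i \in s -> l i p = 0) -> r p = 0) ->
  exists2 b : seq (L * K), {subset unzip1 b <= s} &
    forall p, Q p -> r p = \sum_(x <- b) x.2 * l x.1 p.
Proof.
move=> + + ll; elim: s r Q => [|i s IHs] r Q Ql rl ker.
  by exists [::] => // p Qp; rewrite big_nil ker.
pose Q' : set {poly K} := [set p | Q p /\ l i p = 0].
have [||b sb rb] := IHs r Q' _ rl.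
- move=> a p q [Qp lp] [Qq lq]; split; first exact: Ql.
  by rewrite ll lp lq /= mulr0 addr0.
- by move=> p [Qp lp] ls; apply: ker => // j /predU1P[->|/ls].
pose r' p := r p - \sum_(x <- b) x.2 * l x.1 p.
have r'l a p q : r' (a *: p + q) = a * r' p + r' q.
  rewrite /r' rl mulrBr mulr_sumr.
  have -> : \sum_(x <- b) x.2 * l x.1 (a *: p + q) =
      \sum_(x <- b) a * (x.2 * l x.1 p) + \sum_(x <- b) x.2 * l x.1 q.
    by rewrite -big_split; apply: eq_bigr => x _; rewrite ll /= mulrDr mulrCA.
  by rewrite opprD addrACA.
have r'0 p : Q p -> l i p = 0 -> r' p = 0.
  by move=> Qp lp; rewrite /r' rb ?subrr.
have [[p0 Qp0 lp0]|no] := pselect (exists2 p, Q p & l i p != 0).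
  exists ((i, r' p0 / l i p0) :: b) => [j|p Qp].
    by rewrite !inE /= => /predU1P[->|/sb ->]; rewrite ?eqxx ?orbT.
  rewrite big_cons /=; apply/eqP; rewrite -subr_eq; apply/eqP.
  have := r'0 (- (l i p / l i p0) *: p0 + p) (Ql _ _ _ Qp0 Qp).
  rewrite ll r'l /= mulNr divfK // addNr => /(_ erefl)/eqP.
  rewrite mulNr addrC subr_eq0 => /eqP; rewrite /r' => ->.
  by rewrite mulrC mulrA mulrAC.
exists b => [j /sb js|p Qp]; first by rewrite inE js orbT.
apply/eqP; rewrite -subr_eq0; apply/eqP/r'0 => //.
by apply/eqP; apply: contrapT => /negP lp; apply: no; exists p.
Qed.

Lemma finite_kernel (L : eqType) (l : L -> {poly K} -> K) (S : set L) d Q :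
    poly_subspace Q -> Q 0 -> (forall i, scalar (l i)) ->
    (forall p, Q p -> size p <= d)%N ->
  exists2 s : seq L, (forall i, i \in s -> S i) &
    forall p, Q p -> (forall i, i \in s -> l i p = 0) -> forall i, S i -> l i p = 0.
Proof.
move=> + + ll; pose D Q := [set i : 'I_d.+1 | `[< exists2 p, Q p & size p = i >]]%SET.
have [n] := ubnP #|D Q|; elim: n Q => // n IHn Q /ltnSE leDn Ql Q0 bd.
have [all0|/existsNP[p /not_implyP[Qp /existsNP[i /not_implyP[Si lip]]]]] :=
  pselect (forall p, Q p -> forall i, S i -> l i p = 0).
  by exists [::] => // p Qp _; apply: all0.
have l0 j : l j 0 = 0 by have := ll j (- 1) 0 0; rewrite scaler0 addr0 /= mulN1r addNr.
pose Q' : set {poly K} := [set p | Q p /\ l i p = 0].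
have Q'l : poly_subspace Q'.
  move=> a q q' [Qq lq] [Qq' lq']; split; first exact: Ql.
  by rewrite ll lq lq' /= mulr0 addr0.
have sQ : Q' `<=` Q by move=> q [].
have [|//||q [Qq _]|s sS sl] := IHn Q'.
- apply: leq_trans leDn; apply: proper_card; rewrite finset.properEneq; apply/andP; split.
    apply/eqP => eD; apply: lip.
    suff [//] : Q' p.
    apply: (poly_subspace_eq Ql Q'l) => // q Qq.
    have szq : (size q < d.+1)%N by rewrite ltnS bd.
    have : Ordinal szq \in D Q by rewrite inE; apply/asboolP; exists q.
    by rewrite -eD inE => /asboolP.
  apply/fintype.subsetP => j; rewrite 2!finset.inE => /asboolP[q /sQ Qq sj].
  by apply/asboolP; exists q.
- by split.
- exact: bd.
exists (i :: s) => [j /predU1P[->//|/sS//]|q Qq sq j Sj].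
apply: sl => // [|k ks]; last by rewrite sq // inE ks orbT.
by split=> //; rewrite sq // inE eqxx.
Qed.

End PolySubspaces.

Section Pairing.
Variable K : fieldType.
Implicit Types (g : nat -> K) (p q : {poly K}).

Definition pairing g p : K := \sum_(i < size p) p`_i * g i.

Lemma pairing_widen g p n : (size p <= n)%N ->
  pairing g p = \sum_(i < n) p`_i * g i.
Proof.
move=> pn; rewrite /pairing (big_ord_widen n (fun i => p`_i * g i)) //.
rewrite big_mkcond; apply: eq_bigr => i _; case: ifPn => //.
by rewrite -leqNgt => /(nth_default 0) ->; rewrite mul0r.
Qed.

Lemma pairing_is_scalar g : scalar (pairing g).
Proof.
move=> a p q; pose n := maxn (size p) (size q).
have szn : (size (a *: p + q)%R <= n)%N.
  rewrite (leq_trans (size_polyD _ _)) // geq_max leq_maxr andbT.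
  by rewrite (leq_trans (size_scale_leq _ _)) // leq_maxl.
rewrite (pairing_widen g szn) (pairing_widen g (leq_maxl _ _ : _ <= n)%N).
rewrite (pairing_widen g (leq_maxr _ _ : _ <= n)%N) mulr_sumr -big_split.
by apply: eq_bigr => i _; rewrite coefD coefZ mulrDl mulrA.
Qed.

Lemma pairing0 g : pairing g 0 = 0.
Proof. by rewrite /pairing size_poly0 big_ord0. Qed.

Lemma pairingXn g n : pairing g 'X^n = g n.
Proof.
rewrite /pairing size_polyXn (bigD1 ord_max) //= coefXn eqxx mul1r.
rewrite big1 ?addr0 // => i ni; rewrite coefXn.
by case: eqP => [e|_]; rewrite ?mul0r //; case/eqP: ni; apply: val_inj.
Qed.

Lemma pairing_lead g (a : K) p : p != 0 ->
  pairing (fun i => g i + a * (i == (size p).-1)%:R) p =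
  pairing g p + a * lead_coef p.
Proof.
move=> p0; rewrite /pairing; under eq_bigr => i _ do rewrite mulrDr.
rewrite big_split /=; congr (_ + _).
have ltp : ((size p).-1 < size p)%N by rewrite prednK ?size_poly_gt0.
rewrite (bigD1 (Ordinal ltp)) //= eqxx mulr1 mulrC -lead_coefE.
rewrite big1 ?addr0 // => i ni.
by case: eqP => [e|_]; rewrite ?mulr0 //; case/eqP: ni; apply: val_inj.
Qed.

(* The degrees being distinct, the conditions form a triangular system. *)
Lemma pairing_interpolation (q : nat -> {poly K}) : q 0%N != 0 ->
  (forall n, size (q n) < size (q n.+1))%N ->
  exists g, forall n, pairing g (q n) = 1.
Proof.
move=> q0 qS.
have qlt m n : (m < n)%N -> (size (q m) < size (q n))%N.
  by elim: n => // n IHn; rewrite ltnS leq_eqVlt => /predU1P[->|/IHn]; [|move/ltn_trans; apply].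
have qn n : (n < size (q n))%N.
  by elim: n => [|n IHn]; [rewrite size_poly_gt0|apply: leq_ltn_trans IHn _].
have q_neq0 n : q n != 0 by rewrite -size_poly_gt0 (leq_ltn_trans _ (qn n)).
pose G := fix G n : nat -> K := if n is n'.+1 then
  fun i => G n' i + (1 - pairing (G n') (q n')) / lead_coef (q n') *
                    (i == (size (q n')).-1)%:R else fun=> 0.
have stab i m k : (forall j, m <= j -> i.+1 < size (q j))%N ->
    G (m + k)%N i = G m i.
  move=> im; elim: k => [|k IHk]; first by rewrite addn0.
  rewrite addnS /= IHk; have := im (m + k)%N (leq_addr _ _).
  by case: (size _) => //= s; rewrite ltnS => /ltn_eqF ->; rewrite mulr0 addr0.
exists (fun i => G i.+1 i) => n.
suff -> : pairing (fun i => G i.+1 i) (q n) = pairing (G n.+1) (q n).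
  by rewrite /= pairing_lead // divfK ?lead_coef_eq0 // addrC subrK.
apply: eq_bigr => i _; congr (_ * _); have [ni|lin] := leqP n i.
  rewrite -(subnKC (_ : n.+1 <= i.+1)%N) // stab // => j nj.
  by apply: leq_ltn_trans (qlt _ _ nj).
rewrite -[in RHS](subnKC (_ : i.+1 <= n.+1)%N) ?stab // => [j ij|]; last exact: ltnW.
exact: leq_ltn_trans (qn j).
Qed.

End Pairing.

Section InfiniteBasis.
Variables (K : fieldType) (L : countType) (c : L -> nat -> K).
Implicit Types (a : L -> K) (g : nat -> K) (S : set L) (p : {poly K}).

Definition sums_to a g : Prop := forall i,
  finite_set [set la | a la * c la i <> 0] /\
  g i = \sum_(la \in [set: L]) a la * c la i.

Lemma pairing_sum a g p : sums_to a g ->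
  exists2 X : {fset L}, (forall la, la \notin X -> a la * pairing (c la) p = 0) &
    pairing g p = \sum_(la <- X) a la * pairing (c la) p.
Proof.
move=> ag; pose X := fset_set (\bigcup_(i < size p) [set la | a la * c la i <> 0]).
have Xfin : finite_set (\bigcup_(i < size p) [set la | a la * c la i <> 0]).
  by apply: bigcup_finite => [|i _]; [exact: finite_II|case: (ag i)].
have X0 la i : (i < size p)%N -> la \notin X -> a la * c la i = 0.
  move=> ip; rewrite in_fset_set // notin_setE => nX.
  by apply: contrapT => ne; apply: nX; exists i.
exists X => [la laX|].
  rewrite mulr_sumr big1 // => i _.
  by rewrite mulrCA (X0 la i) ?mulr0.
under [RHS]eq_bigr => la _ do rewrite mulr_sumr.
rewrite exchange_big; apply: eq_bigr => i _ /=.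
rewrite (ag i).2 (fsbigTE X) => [|la laX]; last exact: X0.
by rewrite mulr_sumr; apply: eq_bigr => la _; rewrite mulrCA.
Qed.

Definition annihilator S : set {poly K} :=
  [set p | forall la, ~ S la -> pairing (c la) p = 0].

Lemma annihilator_subspace S : poly_subspace (annihilator S).
Proof.
by move=> b p q Sp Sq la Sla; rewrite pairing_is_scalar Sp ?Sq //= mulr0 addr0.
Qed.

(* A Baire category argument: were the degrees unbounded, one could choose g
   outside of every set of sums whose support meets S in the first n indices. *)
Lemma annihilator_bounded S :
    (forall g, exists2 a, sums_to a g & finite_set [set la | S la /\ a la <> 0]) ->
  exists d, forall p, annihilator S p -> (size p <= d)%N.
Proof.
move=> exp; apply: contrapT => /forallNP unb.
pose Q n : set {poly K} := [set p | annihilator S p /\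
  forall la, (choice.pickle la < n)%N -> pairing (c la) p = 0].
have Ql n : poly_subspace (Q n).
  move=> b p q [Sp np] [Sq nq]; split; first exact: annihilator_subspace.
  by move=> la lan; rewrite pairing_is_scalar np ?nq //= mulr0 addr0.
have Qunb n d : exists2 p, Q n p & (d < size p)%N.
  elim: n d => [|n IHn] d.
    have /existsNP[p /not_implyP[Sp /negP]] := unb d.
    by rewrite -ltnNge => dp; exists p.
  case nla : (@pickle_inv L n) => [la|].
    have [p [[Sp np] lap] dp] :=
      unbounded_kernel (Ql n) (pairing_is_scalar (c la)) IHn d.
    exists p => //; split=> // ka; rewrite ltnS leq_eqVlt => /predU1P[kan|/np//].
    by move: nla; rewrite -kan pickleK_inv => -[->].
  have [p [Sp np] dp] := IHn d; exists p => //; split=> // ka.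
  rewrite ltnS leq_eqVlt => /predU1P[kan|/np//].
  by move: nla; rewrite -kan pickleK_inv.
pose next n d := sval (cid2 (Qunb n d)).
have nextP n d : Q n (next n d) by rewrite /next; case: cid2.
have next_size n d : (d < size (next n d))%N by rewrite /next; case: cid2.
pose q := fix q n := if n is n'.+1 then next n (size (q n')) else next 0%N 0%N.
have qQ n : Q n (q n) by case: n => [|n]; apply: nextP.
have [||g gq] := @pairing_interpolation K q.
- by rewrite -size_poly_gt0 next_size.
- by move=> n; apply: next_size.
have [a ag afin] := exp g.
have [n an] : exists n, forall la, S la -> a la <> 0 -> (choice.pickle la < n)%N.
  exists (\max_(la <- fset_set [set la | S la /\ a la <> 0]) (choice.pickle la)).+1.
  move=> la Sla ala; rewrite ltnS (big_fsetD1 la) ?leq_maxl //.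
  by rewrite in_fset_set // inE.
have [X _ sumX] := pairing_sum (q n) ag.
have /eqP := gq n; rewrite sumX big1 ?(eq_sym 0) ?oner_eq0 // => la _.
have [Sq nq] := qQ n.
have [Sla|/Sq ->] := pselect (S la); last by rewrite mulr0.
have [->|/eqP ala] := eqVneq (a la) 0; first by rewrite mul0r.
by rewrite nq ?mulr0 //; apply: an.
Qed.

(* If no p computes the coefficient of index s, a nonzero expansion of 0 is built
   along S_0 = {s}, S_(j+1) = S_j + supp c(j): the functionals supported on S_j
   have finite dimension, so that each of the finitely supported stages, which
   are killed by them, extends to the next one without changes inside S_j. *)
Lemma dual_functional :
    (forall g, exists a, sums_to a g) ->
    (forall a, sums_to a (fun=> 0) -> forall la, a la = 0) ->
  forall s, exists p, forall la, pairing (c la) p = (la == s)%:R.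
Proof.
move=> surj inj s; apply: contrapT => /forallNP nodual.
pose S := fix S j : set L :=
  if j is j'.+1 then S j' `|` [set la | c la j' <> 0] else [set s].
have Smono j k : (j <= k)%N -> S j `<=` S k.
  move/subnKC <-; elim: (k - j)%N => [|i IHi]; first by rewrite addn0.
  by rewrite addnS => la /IHi; left.
have Sbnd j : exists d, forall p, annihilator (S j) p -> (size p <= d)%N.
  apply: annihilator_bounded => g; have [a ag] := surj g; exists a => //.
  elim: j => [|j IHj].
    by apply: sub_finite_set (finite_set1 s) => la [].
  have : finite_set ([set la | S j la /\ a la <> 0] `|`
                     [set la | a la * c la j <> 0]).
    by rewrite finite_setU; split=> //; case: (ag j).
  apply: sub_finite_set => la [[Sla|/eqP cla] ala]; first by left.
  by right; apply/eqP; rewrite mulf_neq0 //; apply/eqP.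
pose comb (b : seq (L * K)) (h : L -> K) := \sum_(x <- b) x.2 * h x.1.
pose inv j (b : seq (L * K)) := (forall x, x \in b -> S j x.1) /\
  forall p, annihilator (S j) p -> comb b (fun la => pairing (c la) p) = 0.
have inv0 : inv 0%N [:: (s, 1)].
  split=> [x|p Sp]; first by rewrite inE => /eqP ->.
  rewrite /comb big_seq1 mul1r /=; apply/eqP/negPn/negP => ps.
  apply: (nodual ((pairing (c s) p)^-1 *: p + 0)) => la.
  rewrite pairing_is_scalar pairing0 addr0 /=.
  by have [->|/eqP/Sp ->] := eqVneq la s; rewrite ?mulVf ?mulr0.
have [ext extP] : {ext : nat * seq (L * K) -> seq (L * K) & forall x,
    inv x.1 x.2 -> inv x.1.+1 (x.2 ++ ext x) /\
                   forall y, y \in ext x -> ~ S x.1 y.1}.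
  apply: (@choice _ _ (fun x e => inv x.1 x.2 -> inv x.1.+1 (x.2 ++ e) /\
                        forall y, y \in e -> ~ S x.1 y.1)) => -[j b] /=.
  have [[bS bker]|] := pselect (inv j b); last by exists [::].
  have [d Sd] := Sbnd j.+1.
  pose l la p := pairing (c la) p.
  have ll la : scalar (l la) by apply: pairing_is_scalar.
  have Ql := @annihilator_subspace (S j.+1).
  have [la _|t tS tker] := finite_kernel (S j.+1 `\` S j) Ql _ ll Sd.
    exact: pairing0.
  have [||e et eb] := @kernel_combination K L (fun p => - comb b (l^~ p)) l t _ Ql _ ll.
  - move=> k p q; rewrite /comb /= mulrN mulr_sumr -opprD -big_split /=.
    by congr (- _); apply: eq_bigr => x _; rewrite ll /= mulrDr mulrCA.
  - move=> p Sp tp; rewrite bker ?oppr0 // => la nSla.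
    have [Sla|/Sp//] := pselect (S j.+1 la).
    exact: tker.
  have eS x : x \in e -> (S j.+1 `\` S j) x.1.
    by move=> xe; apply/tS/et/map_f.
  exists e => _; split; last by move=> x /eS[].
  split=> [x|p Sp]; first by rewrite mem_cat => /orP[/bS|/eS[]//]; left.
  by rewrite /comb big_cat /= -(eb p Sp) /comb subrr.
pose B := fix B j := if j is j'.+1 then B j' ++ ext (j', B j') else [:: (s, 1)].
have Binv j : inv j (B j) by elim: j => // j IHj; have [] := extP (j, B j) IHj.
have Bext j y : y \in ext (j, B j) -> ~ S j y.1.
  by have [_] := extP (j, B j) (Binv j); apply.
pose coef b la := comb b (fun ka => (ka == la)%:R).
have coef_cat b1 b2 la : coef (b1 ++ b2) la = coef b1 la + coef b2 la.
  by rewrite /coef /comb big_cat.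
have coef0 b la : la \notin unzip1 b -> coef b la = 0.
  move=> nb; rewrite /coef /comb big_seq big1 // => x xb.
  by case: eqP => [e|]; rewrite ?mulr0 //; case/negP: nb; rewrite -e map_f.
have Bcoef j k la : (j <= k)%N -> S j la -> coef (B k) la = coef (B j) la.
  move/subnKC <- => Sla; elim: (k - j)%N => [|i IHi]; first by rewrite addn0.
  rewrite addnS /= coef_cat IHi (coef0 (ext _)) ?addr0 //; apply/mapP => -[y ye yla].
  by apply: (Bext _ _ ye); rewrite -yla; apply: (Smono j) => //; apply: leq_addr.
pose A la := coef (B (xget 0%N [set j | S j la])) la.
have AE j la : S j la -> A la = coef (B j) la.
  move=> Sla; rewrite /A; set k := xget _ _.
  have Sk : S k la by apply: (@xgetPex _ 0%N [set j | S j la]); exists j.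
  by have [jk|/ltnW kj] := leqP j k; [apply: Bcoef|apply/esym/Bcoef].
have : A s = 1 by rewrite (AE 0%N) // /coef /comb big_seq1 eqxx mulr1.
rewrite inj => [/eqP|i]; first by rewrite eq_sym oner_eq0.
pose X : {fset L} := [fset la | la in unzip1 (B i.+1)]%fset.
have X0 la : la \notin X -> A la * c la i = 0.
  have [->|/eqP cla] := eqVneq (c la i) 0; first by rewrite mulr0.
  rewrite !inE /= => laB; rewrite (AE i.+1); last by right.
  by rewrite coef0 ?mul0r.
split.
  apply: sub_finite_set (finite_fset X) => la /= Ala.
  by apply: contrapT => /negP /X0.
rewrite (fsbigTE X) // -[LHS]((Binv i.+1).2 'X^i); last first.
  move=> la nS; rewrite pairingXn; apply: contrapT => cla.
  by apply: nS; right.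
have -> : \sum_(la <- X) A la * c la i =
    \sum_(la <- X) \sum_(x <- B i.+1) x.2 * (x.1 == la)%:R * c la i.
  apply: eq_big_seq => la; rewrite !inE /= => /mapP[x xB ->].
  by rewrite (AE _ _ ((Binv i.+1).1 x xB)) mulr_suml.
rewrite exchange_big; apply: eq_big_seq => x xB /=.
rewrite pairingXn (big_fsetD1 x.1) /=; last by rewrite !inE /= map_f.
rewrite eqxx mulr1 big1_fset ?addr0 // => la; rewrite in_fsetD1 => /andP[+ _] _.
by rewrite eq_sym => /negPf ->; rewrite mulr0 mul0r.
Qed.

End InfiniteBasis.

Section MonomialOrbits.
Implicit Types m : mon.

Definition mon_orbit m : set mon :=
  [set m' | exists2 s, bijective s & m' = rename_mon s m].

Definition orbit_repr m : mon := xget mset0 (mon_orbit m).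

Lemma rename_mon_comp s t m : bijective s -> bijective t ->
  rename_mon s (rename_mon t m) = rename_mon (s \o t) m.
Proof.
move=> sb tb; have [s' ss' s's] := sb; have [t' tt' t't] := tb.
apply/msetP => i; have -> : i = s (t (t' (s' i))) by rewrite t't s's.
by rewrite !rename_monE //; apply: bij_comp.
Qed.

Lemma mon_orbit_rename s m : bijective s ->
  mon_orbit (rename_mon s m) = mon_orbit m.
Proof.
move=> sb; have [s' ss' s's] := sb; have s'b : bijective s' by exists s.
apply/seteqP; split=> _ [t tb ->].
  by exists (t \o s); rewrite ?rename_mon_comp //; apply: bij_comp.
exists (t \o s'); first exact: bij_comp.
by rewrite -rename_mon_comp // (rename_monK ss' s's).
Qed.

Lemma mon_orbit_refl m : mon_orbit m m.
Proof.
exists id; first by exists id.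
by rewrite /rename_mon map_id seq_mset_id.
Qed.

Lemma orbit_reprP m : mon_orbit m (orbit_repr m).
Proof. by apply: xgetPex; exists m; apply: mon_orbit_refl. Qed.

Lemma orbit_repr_rename s m : bijective s ->
  orbit_repr (rename_mon s m) = orbit_repr m.
Proof. by move=> sb; rewrite /orbit_repr mon_orbit_rename. Qed.

Lemma orbit_repr_id m : orbit_repr (orbit_repr m) = orbit_repr m.
Proof. by have [s sb {1}->] := orbit_reprP m; rewrite orbit_repr_rename. Qed.

Lemma size_rename_mon s m : size (rename_mon s m) = size m.
Proof.
by rewrite /rename_mon (perm_size (perm_eq_seq_mset _)) size_map.
Qed.

Lemma infinite_orbit_repr : infinite_set (range orbit_repr).
Proof.
move=> /(finite_image (fun m => size m)) fin; apply: infinite_nat.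
apply: sub_finite_set fin => n _; pose m : mon := seq_mset (nseq n 0%N).
exists (orbit_repr m); first by exists m.
have [s _ ->] := orbit_reprP m; rewrite size_rename_mon.
by rewrite (perm_size (perm_eq_seq_mset _)) size_nseq.
Qed.

Lemma mon_orbit_enumeration : exists (ix : mon -> nat) (e : nat -> mon),
  [/\ forall s m, bijective s -> ix (rename_mon s m) = ix m,
      forall i, ix (e i) = i &
      forall (R : Type) (f : symser R) m, mcoef f (e (ix m)) = mcoef f m].
Proof.
have /card_set_bijP[h [_ hinj hsurj]] : (range orbit_repr #= [set: nat])%card.
  apply: eq_card_nat; [exact: countableP|exact: infinite_orbit_repr].
have [e eP] : {e : nat -> mon & forall i, orbit_repr (e i) = e i /\ h (e i) = i}.
  apply: (@choice _ _ (fun i m => orbit_repr m = m /\ h m = i)) => i.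
  have [_ [m _ <-] hm] := hsurj i Logic.I.
  by exists (orbit_repr m); rewrite orbit_repr_id.
exists (h \o orbit_repr), e; split=> [s m sb|i|R f m] /=.
- by rewrite orbit_repr_rename.
- by case: (eP i) => -> .
have [ee he] := eP (h (orbit_repr m)).
have -> : e (h (orbit_repr m)) = orbit_repr m.
  by apply: hinj => //; rewrite inE; [exists (e (h (orbit_repr m)))|exists m].
by have [s sb ->] := orbit_reprP m; rewrite mcoefP.
Qed.

End MonomialOrbits.

Section ContinuousFunctionals.
Variable K : fieldType.
Implicit Types (F : intpart -> symser K) (phi : {scalar symser K}) (g : symser K).

Lemma mcoef_sum (I : Type) (r : seq I) (u : I -> symser K) m :
  mcoef (\sum_(i <- r) u i) m = \sum_(i <- r) mcoef (u i) m.
Proof. by apply: (big_morph (fun f : symser K => mcoef f m)). Qed.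

Lemma scalar_ex (phi : symser K -> K) : scalar phi -> exists psi : {scalar symser K}, psi =1 phi.
Proof.
move=> phil; pose phiL := GRing.isLinear.Build K (symser K) K *%R phi phil.
pose psi : {scalar symser K} := HB.pack phi phiL.
by exists psi.
Qed.

Lemma continuous_has_sum F phi (a : intpart -> K) g :
    continuous_functional phi -> has_sum (fun la => a la *: F la) g ->
  exists2 X : {fset intpart}, (forall la, la \notin X -> a la * phi (F la) = 0) &
    phi g = \sum_(la <- X) a la * phi (F la).
Proof.
move=> [M Mphi] ag.
pose T := \bigcup_(m in [set` M]) [set la | mcoef (a la *: F la) m <> 0].
have Tfin : finite_set T.
  by apply: bigcup_finite => [|m _]; [exact: finite_seq|case: (ag m)].
pose X := fset_set T.
have X0 la m : m \in M -> la \notin X -> mcoef (a la *: F la) m = 0.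
  move=> mM; rewrite in_fset_set // notin_setE => nT.
  by apply: contrapT => ne; apply: nT; exists m.
exists X => [la laX|].
  by rewrite -linearZ /= Mphi // => m mM; apply: X0.
have : phi (g - \sum_(la <- X) a la *: F la) = 0.
  apply: Mphi => m mM; rewrite /= mcoef_sum (ag m).2 (fsbigTE X) ?subrr //.
  by move=> la; apply: X0.
rewrite linearB linear_sum => /eqP; rewrite subr_eq0 => /eqP ->.
by apply: eq_bigr => la _; rewrite linearZ.
Qed.

Lemma continuous_mulr (phi : symser K -> K) h :
  continuous_functional phi -> continuous_functional (fun g => phi (g * h)).
Proof.
move=> [M Mphi].
exists [seq p.1 | m <- M, p <- fset_set (mon_pairs m)] => g g0.
apply: Mphi => m mM; rewrite /= mulcoefE big_seq big1 // => p pm.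
rewrite g0 ?mul0r //; apply/allpairsPdep.
by exists m, p.
Qed.

Lemma continuous_comp (phi : symser K -> K) (w : symser K -> symser K) :
  continuous_functional phi -> continuous_operator w ->
  continuous_functional (phi \o w).
Proof.
move=> [M Mphi] wc; have [N NP] := choice wc.
exists (flatten [seq N m | m <- M]) => g g0; apply: Mphi => m mM.
by apply: NP => n nN; apply: g0; apply/flatten_mapP; exists m.
Qed.

Definition is_dual F phi la : Prop :=
  continuous_functional phi /\ forall ka, phi (F ka) = (ka == la)%:R.

Lemma is_dual_coef F phi la (a : intpart -> K) g : is_dual F phi la ->
  has_sum (fun ka => a ka *: F ka) g -> phi g = a la.
Proof.
move=> [phic phiF] ag; have [X X0 ->] := continuous_has_sum phic ag.
have [laX|/X0] := boolP (la \in X); last first.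
  rewrite phiF eqxx mulr1 => ala; rewrite ala big1 // => ka _; rewrite phiF.
  by have [->|] := eqVneq ka la; rewrite ?ala ?mulr0 ?mul0r.
rewrite (big_fsetD1 la) //= phiF eqxx mulr1 big1_fset ?addr0 // => ka.
by rewrite in_fsetD1 phiF => /andP[/negPf -> _] _; rewrite mulr0.
Qed.

Lemma is_dual_ex F la : unique_expansion F -> exists phi, is_dual F phi la.
Proof.
move=> Fexp; have [ix [e [ixs ixe eix]]] := mon_orbit_enumeration.
pose c ka i := mcoef (F ka) (e i).
have [||p pP] := @dual_functional K intpart c _ _ la.
- move=> g; have gs : is_symmetric (g \o ix) by move=> s sb m /=; rewrite ixs.
  have [a [ag _]] := Fexp (SymSer gs); exists a => i.
  by have [? /=] := ag (e i); rewrite ixe.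
- move=> a a0 ka; have [b [_ buniq]] := Fexp 0.
  transitivity (b ka); last first.
    rewrite (buniq (fun=> 0)) // => m; split.
      by apply: (sub_finite_set _ (finite_set0 _)) => k /=; rewrite mul0r.
    by rewrite fsbig1 // => k _ /=; rewrite mul0r.
  rewrite (buniq a) // => m; have [fin sum0] := a0 (ix m).
  have ce k : c k (ix m) = mcoef (F k) m by apply: eix.
  split=> /=; first by apply: sub_finite_set fin => k /=; rewrite ce.
  by rewrite [LHS]sum0; apply: eq_fsbigr => k _; rewrite ce.
have [|phi phiE] := @scalar_ex (fun g => pairing (fun i => mcoef g (e i)) p).
  move=> k f g /=; rewrite /pairing mulr_sumr -big_split.
  by apply: eq_bigr => i _ /=; rewrite mulrDr mulrCA.
exists phi; split=> [|ka]; last by rewrite phiE pP.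
exists [seq e i | i <- iota 0 (size p)] => g g0.
rewrite phiE /pairing big1 // => i _; rewrite g0 ?mulr0 //.
by apply/map_f; rewrite mem_iota ltn_ord.
Qed.

End ContinuousFunctionals.

Lemma size_part1_conj (la : intpart) : size la = part1 (conj_part la).
Proof.
case: la => -[//|x s] xs; rewrite /part1 /= /conj_seq /=.
case: x xs => [|x] xs; first by exfalso; move: (xs); rewrite /is_part inE eqxx andbF.
rewrite /=; congr (_.+1); apply/esym/eqP; rewrite -all_count.
by apply/allP => y ys; rewrite lt0n; apply: contraTneq xs => y0;
  rewrite /is_part inE -y0 ys orbT andbF.
Qed.

Lemma finite_bounded_parts k l :
  finite_set [set la : intpart | (part1 la < k)%N /\ (size la < l)%N].
Proof.
pose h (b : {bseq l of 'I_k}) : seq nat := [seq val i | i <- b].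
apply: (@sub_finite_set _ _ (parts @^-1` range h)); last first.
  apply: finite_preimage; first by move=> x y _ _; apply: val_inj.
  exact/finite_image/finite_finset.
move=> [s ps] [/= hs szs]; rewrite /part1 /= in hs.
have /andP[ss _] := ps.
have sk : all (fun i => i < k)%N s.
  case: s ss hs {ps szs} => //= x s ss xk; rewrite xk /=.
  apply/allP => y ys; apply: leq_ltn_trans xk.
  have gt : transitive geq by move=> a b c ba cb; apply: leq_trans cb ba.
  by have /allP/(_ y ys) := order_path_min gt ss.
have szb : (size (pmap insub s : seq 'I_k) <= l)%N.
  by rewrite size_pmap (leq_trans (count_size _ _)) // ltnW.
exists (Bseq szb) => //; rewrite /h /=.
elim: s sk {ps ss hs szs szb} => //= x s IHs /andP[xk sk].
by rewrite insubT /= -[in RHS](IHs sk).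
Qed.

Lemma product_part1_bound (K : fieldType) (F : intpart -> symser K) Om f mu nu :
    unique_expansion F -> nondegenerate_kernel F Om -> pieri_formula F f Om ->
    damping_condition f ->
  exists k, forall a la, has_sum (fun ka => a ka *: F ka) (F mu * F nu) ->
    a la <> 0 -> (part1 la < k)%N.
Proof.
move=> Fexp [Omx _] pieri damp.
have [n nP] := Omx nu; have [k kP] := damp mu n; exists k => a la ag ala.
apply: contrapT => lak; apply: ala.
have [phi phid] := is_dual_ex la Fexp; rewrite -(is_dual_coef phid ag) mulrC.
have [|psi psiE] := @scalar_ex K (fun g => phi (g * F mu)).
  by move=> c g h /=; rewrite mulrDl -scalerAl linearP.
rewrite -psiE; apply: nP => [|b bn].
  have -> : (psi : symser K -> K) = fun g => phi (g * F mu) by apply/funext.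
  by apply: continuous_mulr; case: phid.
rewrite psiE (is_dual_coef phid (pieri mu b)).
by apply: contrapT => fb; apply: lak; apply: kP; exists b.
Qed.

Theorem theorem8p4 (K : fieldType) (F : intpart -> symser K) :
  damping_family F -> basis_phenomenon F.
Proof.
move=> [_ Findep Fexp [w [wK wc wF]] [Om [f [Omnd pieri damp _]]]].
split=> // mu nu.
have [k kP] := product_part1_bound mu nu Fexp Omnd pieri damp.
have [l lP] :=
  product_part1_bound (conj_part mu) (conj_part nu) Fexp Omnd pieri damp.
have [a [ag _]] := Fexp (F mu * F nu).
have [a' [ag' _]] := Fexp (F (conj_part mu) * F (conj_part nu)).
have Finj : injective F.
  move=> la ka Flk; apply: contrapT => /eqP lk.
  have := Findep [fset la; ka]%fset (fun x => if x == la then 1 else -1).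
  rewrite big_fsetU1 ?inE //= big_seq_fset1 eqxx eq_sym (negPf lk) Flk.
  rewrite scale1r scaleN1r subrr => /(_ erefl la); rewrite !inE eqxx => /(_ isT)/eqP.
  by rewrite oner_eq0.
have conj_inj : injective conj_part.
  by move=> la ka lk; apply: Finj; apply: (inv_inj wK); rewrite !wF lk.
have aconj la : a' (conj_part la) = a la.
  have [phi phid] := is_dual_ex (conj_part la) Fexp.
  have [|psi psiE] := @scalar_ex K (phi \o w).
    by move=> c g h /=; rewrite !linearP.
  have psid : is_dual F psi la.
    split=> [|ka]; last by rewrite psiE /= wF phid.2 (inj_eq conj_inj).
    have -> : (psi : symser K -> K) = phi \o w by apply/funext.
    by apply: continuous_comp wc; case: phid.
  rewrite -(is_dual_coef psid ag) psiE /= rmorphM /= !wF.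
  by rewrite (is_dual_coef phid ag').
pose S := fset_set [set la : intpart | (part1 la < k)%N /\ (size la < l)%N].
have S0 la : la \notin S -> a la = 0.
  rewrite in_fset_set ?notin_setE; last exact: finite_bounded_parts.
  move=> nS; apply: contrapT => ala; apply: nS; split; first exact: kP ag ala.
  by rewrite /= size_part1_conj; apply: lP ag' _; rewrite aconj.
exists S, a; apply: symserP => m; rewrite (ag m).2 mcoef_sum (fsbigTE S) //.
by move=> la /S0 /= ->; rewrite mul0r.
Qed.
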